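(* Let $X$ and $Y$ be independent real-valued random variables, both with distribution function $F$ on $(\mathbb{R},\mathcal{B})$, and let $\psi:\mathbb{R}\to[0,\infty)$ be a nonnegative Borel measurable function. For $0<p<1$, $$\left\{E\left(\left(\frac{E\left(\psi(Y)\mathbf{1}_{[Y\ge X]}\mid X\right)}{F(X-)}\right)^p\right)\right\}^{1/p}\ge\frac{p}{1-p}\left\{E\left(\psi^p(Y)\right)\right\}^{1/p}$$ holds.
   Context: $\mathcal{B}$ is the Borel $\sigma$-algebra on $\mathbb{R}$, $F(x)=P(X\le x)=P(Y\le x)$ is an arbitrary distribution function (atoms are allowed), $F(x-)=\lim_{y\uparrow x}F(y)=P(X<x)$, $\mathbf{1}_{[\cdot]}$ denotes an indicator, $\psi^p(y)=(\psi(y))^p$, and $E(\cdot\mid X)$ denotes conditional expectation given $X$; thus $E(\psi(Y)\mathbf{1}_{[Y\ge X]}\mid X)=\int_{[X,\infty)}\psi\,dF$ almost surely. All expectations and conditional expectations are of nonnegative quantities and take values in $[0,\infty]$, with $\infty^p=\infty^{1/p}=\infty$. For the quotient, $c/0=\infty$ if $c\in(0,\infty]$, and $0/0=0$. *)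

(* Defs.v *)
From HB Require Import structures.
From mathcomp Require Import all_boot all_order all_algebra.
From mathcomp Require Import all_classical all_reals all_analysis.
From mathcomp Require Import measurable_realfun.

Set Implicit Arguments.
Unset Strict Implicit.
Unset Printing Implicit Defensive.

Import Order.TTheory GRing.Theory Num.Theory.
Import numFieldNormedType.Exports.

Local Open Scope classical_set_scope.
Local Open Scope ring_scope.

Definition independent_RVs (d : measure_display) (T : measurableType d)
    (R : realType) (P : probability T R) (X Y : {RV P >-> R}) : Prop :=
  forall A B : set R, measurable A -> measurable B ->
    (P (X @^-1` A `&` Y @^-1` B) = P (X @^-1` A) * P (Y @^-1` B))%E.

(* [C] is a version of E(Z | X), for [Z] with values in [0, +oo]: it is
   measurable for the sigma-algebra generated by [X] and has the same integral
   as [Z] on each set of that sigma-algebra. As [Z] need not be integrable,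
   the integrals may be [+oo]. *)
Definition is_cond_expectation (d : measure_display) (T : measurableType d)
    (R : realType) (P : probability T R) (X : {RV P >-> R})
    (Z C : T -> \bar R) : Prop :=
  [/\ forall w, (0 <= C w)%E,
      measurable_fun setT (C : g_sigma_algebra_preimageType X -> \bar R) &
      forall A : set T, g_sigma_algebra_preimage X A ->
        (\int[P]_(w in A) C w = \int[P]_(w in A) Z w)%E].

Definition is_distribution_function (d : measure_display)
    (T : measurableType d) (R : realType) (P : probability T R)
    (X : {RV P >-> R}) (F : R -> R) : Prop :=
  forall x : R, cdf X x = (F x)%:E.

Definition left_limit (R : realType) (F : R -> R) (x : R) : R :=
  lim (F y @[y --> x^'-]).

(* Main.v *)
(* Let mu be the common law of X and Y, F(x-) = mu ]-oo, x[, G(x) the integral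
   of psi over [x, +oo[ against mu, H(x) = G(x) / F(x-), A the integral of H^p,
   and q = 1 - p.  Two one-sided inequalities, which hold even with atoms,
   replace integration by parts:
     p \int_(y >= x) psi(y) G(y)^(p-1) dmu(y) <= G(x)^p,
     q \int_(x <= y) F(x-)^(-p) dmu(x) >= F(y-)^q.
   Both follow from the layer-cake formula, because the part of the mass of
   psi dmu where G <= t is at most t, and the part of the mass of mu on
   ]-oo, y] where F(x-) < t is at least min(t, F(y-)).  Inserting the first in A
   and exchanging the order of integration gives, by the second,
     A >= lam \int psi H^(p-1) dmu,  where lam = p / q.
   The weighted AM-GM inequality
     lam^p psi^p = (lam psi H^(p-1))^p (H^p)^q <= p lam psi H^(p-1) + q H^p
   then integrates to lam^p \int psi^p dmu <= p A + q A = A. *)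
Require Import Defs.
From HB Require Import structures.
From mathcomp Require Import all_boot all_order all_algebra.
From mathcomp Require Import all_classical all_reals all_analysis.
From mathcomp Require Import measurable_realfun.
From mathcomp Require Import ring lra.

Set Implicit Arguments.
Unset Strict Implicit.
Unset Printing Implicit Defensive.

Import Order.TTheory GRing.Theory Num.Theory.
Import numFieldNormedType.Exports.

Local Open Scope classical_set_scope.
Local Open Scope ring_scope.

(** * Integrals of real powers over half-lines *)

Lemma cvgy_powR (R : realType) (c : R) : c < 0 -> x `^ c @[x --> +oo%R] --> 0.
Proof.
move=> c0; apply/cvgrPdist_lt => e e0; near=> x.
have x0 : 0 < x by near: x; exact: nbhs_pinfty_gt.
rewrite sub0r normrN ger0_norm ?powR_ge0//.
have ex : e `^ c^-1 < x by near: x; exact: nbhs_pinfty_gt.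
have -> : e = (e `^ c^-1) `^ c.
  by rewrite -powRrM mulVf ?powRr1 ?ltW// lt_eqF.
rewrite -(opprK c) !(powRN _ (- c)) ltf_pV2 ?posrE ?powR_gt0//.
by apply: gt0_ltr_powR; rewrite ?oppr_gt0 ?nnegrE ?ltW ?powR_gt0 ?opprK.
Unshelve. all: by end_near. Qed.

Lemma integral_powR_itvcy (R : realType) (m c : R) : 0 < m -> c < -1 ->
  (\int[lebesgue_measure]_(s in `[m, +oo[) (s `^ c)%:E =
   (- (m `^ (c + 1) / (c + 1)))%:E)%E.
Proof.
move=> m0 c1.
have c10 : c + 1 < 0 by lra.
have dF (x : R) : 0 < x ->
    is_derive x 1 (fun x : R => x `^ (c + 1) / (c + 1)) (x `^ c).
  move=> x0; have -> : x `^ c = (c + 1)^-1 *: ((c + 1) * x `^ (c + 1 - 1)).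
    by rewrite addrK /GRing.scale/= mulKf// lt_eqF.
  rewrite (_ : (fun x : R => _) =
      (c + 1)^-1 \*: (fun y : R => y `^ (c + 1) : R^o)).
    exact: (@is_deriveZ _ _ _ _ _ x 1 _ (is_derive1_powR (c + 1) x0)).
  by apply/funext => y /=; rewrite mulrC.
have cp (x : R) : 0 < x -> {for x, continuous (fun y : R => y `^ c)}.
  move=> x0; apply/differentiable_continuous/derivable1_diffP.
  by have [] := is_derive1_powR c x0.
have cF (x : R) : 0 < x ->
    {for x, continuous (fun y : R => y `^ (c + 1) / (c + 1))}.
  by move=> /dF[d _]; exact/differentiable_continuous/derivable1_diffP.
rewrite (@ge0_continuous_FTC2y _ _ (fun x : R => x `^ (c + 1) / (c + 1)) _ 0).
- by rewrite add0e.
- by move=> x _; exact: powR_ge0.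
- apply/continuous_within_itvcyP; split => [x mx|].
    by apply: cp; move: mx; rewrite in_itv/= andbT; exact: lt_trans.
  by apply: cvg_at_right_filter; exact: cp.
- by rewrite -(mul0r (c + 1)^-1); apply: cvgMr_tmp; exact: cvgy_powR.
- by move=> x mx; have := dF _ (lt_trans m0 mx); case.
- by apply: cvg_at_right_filter; exact: cF.
- move=> x; rewrite in_itv/= andbT => mx; rewrite derive1E.
  by have := dF _ (lt_trans m0 mx); case.
Qed.

Lemma integral_min_powR (R : realType) (L a : R) : 0 < L -> 0 < a < 1 ->
  (\int[lebesgue_measure]_(s in `]0%R, +oo[) (Num.min L (s `^ (- a^-1)))%:E =
   (L `^ (1 - a) / (1 - a))%:E)%E.
Proof.
move=> L0 /andP[a0 a1].
have m0 : 0 < L `^ (- a) by exact: powR_gt0.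
have mmin : measurable_fun [set: R] (fun s : R => Num.min L (s `^ (- a^-1))).
  by apply: measurable_minr => //; exact: measurable_powR.
have mL : (L `^ (- a)) `^ (- a^-1) = L.
  by rewrite -powRrM mulrNN divff ?gt_eqF// powRr1// ltW.
have ia1 : - a^-1 < -1 by rewrite ltrN2 invf_gt1.
have powN (s t : R) : 0 < s -> s <= t -> t `^ (- a^-1) <= s `^ (- a^-1).
  move=> s0 st; have t0 := lt_le_trans s0 st.
  rewrite !powRN lef_pV2 ?posrE ?powR_gt0//.
  by rewrite ge0_ler_powR ?nnegrE ?invr_ge0// ltW.
rewrite (_ : `]0, +oo[%classic = `]0%R, L `^ (- a)[ `|`
    `[L `^ (- a), +oo[); last first.
  apply/seteqP; split => x /=; rewrite !in_itv/= !andbT.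
    by move=> ->; case: ltP; [left|right].
  by move=> [/andP[]//|]; exact: lt_le_trans.
rewrite ge0_integral_setU//=; last 3 first.
- by apply/measurable_EFinP; exact: measurable_funTS.
- by move=> x _; rewrite lee_fin le_min (ltW L0) powR_ge0.
- apply/disj_setPS => x /=; rewrite !in_itv/= andbT => -[/andP[_ xm] mx].
  by move: (lt_le_trans xm mx); rewrite ltxx.
rewrite (eq_integral (cst L%:E)); last first.
  move=> x; rewrite inE/= in_itv/= => /andP[x0 xm]; congr EFin; apply/min_idPl.
  by rewrite -[leLHS]mL powN// ltW.
rewrite [X in (_ + X)%E](eq_integral
    (fun s : measurableTypeR R => (s `^ (- a^-1))%:E)); last first.
  move=> x; rewrite inE/= in_itv/= andbT => mx; congr EFin; apply/min_idPr.
  by rewrite -[leRHS]mL powN.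
rewrite integral_powR_itvcy// integral_cst//= lebesgue_measure_itv/= lte_fin m0.
rewrite sube0 -EFinM -EFinD; congr EFin.
rewrite powRD; last by apply/implyP => _; rewrite gt_eqF.
rewrite mL powRr1 ?ltW// powRB; last by apply/implyP => _; rewrite gt_eqF.
rewrite powRN powRr1 ?ltW//.
have La0 : L `^ a != 0 by rewrite gt_eqF ?powR_gt0.
have a10 : 1 - a != 0 by rewrite gt_eqF// subr_gt0.
by field; rewrite a10 La0 gt_eqF//= addrC lt_eqF// subr_lt0.
Qed.

(** * The layer-cake formula with a weight *)

Lemma measurable_natr_bool d (T : measurableType d) (R : realType)
    (b : T -> bool) : measurable_fun setT b ->
  measurable_fun setT (fun x => (b x)%:R : R).
Proof.
move=> mb; rewrite (_ : (fun _ => _) = (fun x => if b x then 1 else 0)).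
  exact: measurable_fun_ifT.
by apply/funext => x; case: (b x).
Qed.

Lemma integral_natr_bool d (T : measurableType d) (R : realType)
    (mu : measure T R) (f : T -> R) (b : T -> bool) (D : set T) :
    (forall x, D x <-> b x) ->
  (\int[mu]_(x in D) (f x)%:E = \int[mu]_x (f x * (b x)%:R)%:E)%E.
Proof.
move=> Db; rewrite integral_mkcond; apply: eq_integral => x _.
rewrite patchE; case: ifPn => [|/negP]; rewrite inE Db.
  by move=> ->; rewrite mulr1.
by move=> /negP/negbTE ->; rewrite mulr0.
Qed.

Lemma measurable_layers d (T : measurableType d) (R : realType)
    (mu : {sigma_finite_measure set T -> \bar R}) (w f : T -> R) :
    measurable_fun setT w -> measurable_fun setT f -> (forall x, 0 <= w x) ->
  measurable_fun setT (fun s : measurableTypeR R =>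
    \int[mu]_x (w x * (s < f x)%R%:R)%:E)%E.
Proof.
move=> mw mf w0.
pose k (z : T * measurableTypeR R) := (w z.1 * (z.2 < f z.1)%R%:R)%:E.
have mk : measurable_fun setT k.
  apply/measurable_EFinP/measurable_funM; first exact: measurableT_comp.
  apply: measurable_natr_bool; apply: measurable_fun_ltr => //.
  exact: measurableT_comp.
have k0 z : (0 <= k z)%E by rewrite lee_fin mulr_ge0.
exact: (measurable_fun_fubini_tonelli_G k mk k0).
Qed.

(** The value [f x] is the length of the interval []0, f x[], and Tonelli exchanges the two
    integrals. *)
Lemma layer_cake (d : measure_display) (T : measurableType d) (R : realType)
    (mu : {sigma_finite_measure set T -> \bar R}) (w f : T -> R) :
  measurable_fun setT w -> measurable_fun setT f ->
  (forall x, 0 <= w x) -> (forall x, 0 <= f x) ->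
  (\int[mu]_x (w x * f x)%:E =
   \int[lebesgue_measure]_(s in `]0%R, +oo[) \int[mu]_x
     (w x * (s < f x)%R%:R)%:E)%E.
Proof.
move=> mw mf w0 f0.
(* The condition [0 < z.2] sits in the integrand so that Tonelli applies on the whole product
   space. *)
pose k (z : T * measurableTypeR R) := (w z.1 * (0 < z.2 < f z.1)%R%:R)%:E.
have mk : measurable_fun setT k.
  apply/measurable_EFinP/measurable_funM; first exact: measurableT_comp.
  apply: measurable_natr_bool; apply: measurable_and.
    exact: measurable_fun_ltr.
  by apply: measurable_fun_ltr => //; exact: measurableT_comp.
have k0 z : (0 <= k z)%E by rewrite lee_fin mulr_ge0.
have /= H := @fubini_tonelli _ _ _ _ R mu lebesgue_measure k mk k0.
transitivity (\int[mu]_x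
    (\int[lebesgue_measure]_y (w x * (0 < y < f x)%R%:R)%:E))%E.
  apply: eq_integral => x _.
  under eq_integral do rewrite EFinM.
  rewrite ge0_integralZl//=; last 2 first.
  - apply/measurable_EFinP; apply: measurable_natr_bool.
    by apply: measurable_and; exact: measurable_fun_ltr.
  - by rewrite lee_fin.
  rewrite EFinM; congr (_ * _)%E.
  rewrite (eq_integral (fun y : measurableTypeR R => (\1_`]0, f x[ y)%:E)).
    rewrite integral_indic//= setIT lebesgue_measure_itv/= lte_fin.
    case: ltP => [_|fx0]; first by rewrite sube0.
    by congr EFin; apply/eqP; rewrite eq_le fx0 f0.
  by move=> y _; rewrite indicE/= mem_setE in_itv.
rewrite H [RHS]integral_mkcond; apply: eq_integral => s _.
rewrite patchE; case: ifPn.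
  rewrite inE/= in_itv/= andbT => s0.
  by apply: eq_integral => x _; rewrite /k/= s0.
rewrite notin_setE/= in_itv/= andbT => /negP/negbTE s0.
by rewrite integral0_eq// => x _; rewrite /k/= s0 mulr0.
Qed.

(** * Upward closed sets of reals and their exhaustion by half-lines *)

Definition upset (R : realType) (U : set R) := forall x y, U x -> x <= y -> U y.

Lemma upset_measurable (R : realType) (U : set R) : upset U -> measurable U.
Proof.
move=> up; apply: is_interval_measurable => x y Ux Uy z /andP[xz _].
exact: up Ux xz.
Qed.

(** There are three cases: [U] unbounded below, with [u n = - n]; infimum attained, with [u]
    constant; infimum not attained, with [u n = inf U + 1 / (n + 1)]. *)
Lemma upset_bigcup_itv (R : realType) (U : set R) : U !=set0 -> upset U ->
  exists u : nat -> R, [/\ forall n, U (u n),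
    {homo u : m n / (m <= n)%N >-> n <= m} & U = \bigcup_n `[u n, +oo[%classic].
Proof.
move=> U0 up.
have upE (u : nat -> R) : (forall n, U (u n)) ->
    (forall x, U x -> exists n, u n <= x) -> U = \bigcup_n `[u n, +oo[%classic.
  move=> Uu xu; apply/seteqP; split => [x /xu[n nx]|x [n _]].
    by exists n => //=; rewrite in_itv/= nx.
  by rewrite /= in_itv/= andbT; exact: up.
have [lU|nlU] := pselect (has_lbound U); last first.
  exists (fun n => - n%:R); split => [n|m n mn|].
  - apply: contrapT => Un; apply: nlU; exists (- n%:R) => x Ux.
    by rewrite leNgt; apply/negP => /ltW xn; exact/Un/(up _ _ Ux xn).
  - by rewrite lerN2 ler_nat.
  - apply: upE => [n|x _].
      apply: contrapT => Un; apply: nlU; exists (- n%:R) => x Ux.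
      by rewrite leNgt; apply/negP => /ltW xn; exact/Un/(up _ _ Ux xn).
    exists (Num.truncn (- x)).+1; rewrite lerNl; exact/ltW/truncnS_gt.
have [Ui|nUi] := pselect (U (inf U)).
  exists (fun=> inf U); split => //; apply: upE => // x Ux.
  by exists 0%N; exact: ge_inf.
have Uu n : U (inf U + n.+1%:R^-1).
  have [//|y Uy /ltW] := @inf_adherent _ U n.+1%:R^-1 _ (conj U0 lU).
  exact: up.
exists (fun n => inf U + n.+1%:R^-1); split => // [m n mn|].
  by rewrite lerD2l lef_pV2 ?posrE// ler_nat.
apply: upE => // x Ux.
have xi : 0 < x - inf U.
  rewrite subr_gt0 lt_neqAle ge_inf// andbT; apply/eqP => xE.
  by apply: nUi; rewrite xE.
exists (Num.truncn (x - inf U)^-1); rewrite -lerBrDl.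
by rewrite invf_ple ?posrE//; exact/ltW/truncnS_gt.
Qed.

(** Monotone convergence along the half-lines that exhaust [U]. A bound on closed half-lines thus
    passes to level sets of monotone functions, whether these are open or closed at the left end, so
    atoms need no separate treatment. *)
Lemma upset_integral_le (R : realType) (mu : measure R R) (h : R -> \bar R)
    (U : set R) (t : \bar R) : measurable_fun setT h ->
    (forall x, 0 <= h x)%E -> upset U -> (0 <= t)%E ->
    (forall x, U x -> \int[mu]_(y in `[x, +oo[) h y <= t)%E ->
  (\int[mu]_(y in U) h y <= t)%E.
Proof.
move=> mh h0 up t0 Ut.
have [->|U0] := eqVneq U set0; first by rewrite integral_set0.
have [u [Uu u_dec UE]] := upset_bigcup_itv ((set0P _).1 U0) up.
rewrite UE.
have cu : (\int[mu]_(y in `[u n, +oo[) h y)%E @[n --> \oo] -->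
    (\int[mu]_(y in \bigcup_n `[u n, +oo[%classic) h y)%E.
  apply: ge0_nondecreasing_set_cvg_integral => // [m n mn|n].
    by apply/subsetPset; apply: subset_itvr; rewrite bnd_simp; exact: u_dec.
  exact: measurable_funTS.
rewrite -(cvg_lim _ cu)//.
by apply: lime_le; [apply/cvg_ex; eexists; exact: cu|
  apply: nearW => n; exact: Ut].
Qed.

(** * The one-sided inequality for the tail integral G *)

Section weighted_powers.
Variables (R : realType) (mu : probability R R).

Definition tail_integral (psi : R -> R) (x : R) : \bar R :=
  (\int[mu]_(y in `[x, +oo[) (psi y)%:E)%E.

Definition cdf_left (x : R) : R := fine (mu `]-oo, x[%classic).

Variables (psi : R -> R).
Hypotheses (mpsi : measurable_fun setT psi) (psi0 : forall y, 0 <= psi y).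

Local Notation G := (tail_integral psi).

Lemma tail_integralE x : G x = (\int[mu]_y (psi y * (x <= y)%R%:R)%:E)%E.
Proof.
by apply: integral_natr_bool => y; rewrite /= in_itv/= andbT.
Qed.

Lemma tail_integral_ge0 x : (0 <= G x)%E.
Proof. by apply: integral_ge0 => y _; rewrite lee_fin. Qed.

Lemma tail_integral_nonincreasing x y : x <= y -> (G y <= G x)%E.
Proof.
move=> xy; apply: ge0_subset_integral => //.
- by apply/measurable_EFinP; exact: measurable_funTS.
- by move=> z _; rewrite lee_fin.
- by apply: subset_itvr; rewrite bnd_simp.
Qed.

Lemma measurable_tail_integral : measurable_fun setT G.
Proof.
rewrite (_ : tail_integral psi =
    fun x => \int[mu]_y (psi y * (x <= y)%R%:R)%:E)%E; last first.
  by apply/funext => x; exact: tail_integralE.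
apply: (measurable_fun_fubini_tonelli_F
  (fun z : R * R => (psi z.2 * (z.1 <= z.2)%R%:R)%:E)) => /=.
  apply/measurable_EFinP/measurable_funM; first exact: measurableT_comp.
  by apply: measurable_natr_bool; exact: measurable_fun_ler.
by move=> z; rewrite lee_fin mulr_ge0.
Qed.

(** As G is nonincreasing, the level set is upward closed, and a half-line that starts at one of its
    points [x] carries the mass [G x <= t]. *)
Lemma integral_tail_le (t : \bar R) : (0 <= t)%E ->
  (\int[mu]_(y in [set y | G y <= t]) (psi y)%:E <= t)%E.
Proof.
move=> t0; apply: upset_integral_le => //.
- exact/measurable_EFinP.
- by move=> x y /= Gx /tail_integral_nonincreasing /le_trans; exact.
Qed.

(* Where [G y] is [0] or [+oo] the factor [fine (G y) `^ (- a)] is [0], since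
   [fine +oo = 0] and [0 `^ (- a) = 0]. *)
Lemma integral_tail_powR_le (a x : R) : 0 < a < 1 -> (G x < +oo)%E ->
  (\int[mu]_y (psi y * (x <= y)%R%:R * fine (G y) `^ (- a))%:E <=
   (fine (G x) `^ (1 - a) / (1 - a))%:E)%E.
Proof.
move=> a01 Goo; have /andP[a0 a1] := a01.
have G0 y := tail_integral_ge0 y.
have mw : measurable_fun setT (fun y => psi y * (x <= y)%R%:R).
  apply: measurable_funM => //; apply: measurable_natr_bool.
  exact: measurable_fun_ler.
have mg : measurable_fun setT (fun y => fine (G y) `^ (- a)).
  apply: (measurableT_comp (measurable_powR (- a))).
  apply: (measurableT_comp (fine_measurable measurableT)).
  exact: measurable_tail_integral.
have w0 y : 0 <= psi y * (x <= y)%R%:R by rewrite mulr_ge0.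
(* The case [G x = 0] is set apart because [integral_min_powR] needs a positive [L]. *)
have [Gx0|Gxn0] := eqVneq (G x) 0%E.
  rewrite integral0_eq ?Gx0/=.
    by rewrite lee_fin mulr_ge0 ?powR_ge0 ?invr_ge0 ?subr_ge0 ?(ltW a1).
  move=> y _; have [xy|] := leP x y; last by rewrite mulr0 mul0r.
  have -> : G y = 0%E.
    by apply/eqP; rewrite eq_le G0 andbT -Gx0 tail_integral_nonincreasing.
  by rewrite powR0 ?mulr0// oppr_eq0 gt_eqF.
have Gfin : G x \is a fin_num by rewrite ge0_fin_numE.
have L0 : 0 < fine (G x).
  by rewrite fine_gt0// Goo andbT lt_neqAle eq_sym Gxn0 G0.
rewrite layer_cake//; last by move=> y; exact: powR_ge0.
rewrite -integral_min_powR//.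
apply: ge0_le_integral => //.
- by move=> s _; apply: integral_ge0 => y _; rewrite lee_fin mulr_ge0.
- apply: measurable_funTS.
  exact: measurable_layers.
- apply/measurable_EFinP; apply: measurable_funTS.
  by apply: measurable_minr => //; exact: measurable_powR.
move=> s /=; rewrite in_itv/= andbT => s0.
(* Each layer has two bounds: its mass is at most the whole tail [G x], and [s < G y]^ (- a)[means]G
   y < s [^ (- a^-1)], so [integral_tail_le] applies with that threshold. *)
rewrite EFin_min le_min; apply/andP; split.
  rewrite fineK// tail_integralE; apply: ge0_le_integral => //.
  - by move=> y _; rewrite lee_fin mulr_ge0.
  - apply/measurable_EFinP/measurable_funM => //.
    by apply: measurable_natr_bool; exact: measurable_fun_ltr.
  - exact/measurable_EFinP.
  - by move=> y _; rewrite lee_fin ler_piMr// lern1 leq_b1.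
apply: (le_trans _ (integral_tail_le _)); last by rewrite lee_fin powR_ge0.
rewrite [leRHS]integral_mkcond; apply: ge0_le_integral => //.
- by move=> y _; rewrite lee_fin mulr_ge0.
- apply/measurable_EFinP/measurable_funM => //.
  by apply: measurable_natr_bool; exact: measurable_fun_ltr.
- apply/(measurable_restrictT _ _).1.
    apply: upset_measurable => z y /= Gz /tail_integral_nonincreasing zy.
    exact: le_trans zy Gz.
  exact/measurable_EFinP/measurable_funTS.
move=> y _; have [xy|] := leP x y; last first.
  by rewrite mulr0 mul0r; apply: erestrict_ge0 => z _; rewrite lee_fin.
have [sg|] := ltP s; last first.
  by rewrite mulr0; apply: erestrict_ge0 => z _; rewrite lee_fin.
rewrite !mulr1 patchE mem_set//=.
have Gy : G y \is a fin_num.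
  rewrite ge0_fin_numE//.
  exact: le_lt_trans (tail_integral_nonincreasing xy) Goo.
rewrite -(fineK Gy) lee_fin.
(* If [fine (G y)] were [0], its power would be [0] by convention, against [0 < s]. *)
have g0 : 0 < fine (G y).
  rewrite lt_neqAle fine_ge0// andbT; apply/eqP => g0.
  by move: sg; rewrite -g0 powR0 ?oppr_eq0 ?gt_eqF// ltNge ltW.
have -> : fine (G y) = (fine (G y) `^ (- a)) `^ (- a^-1).
  by rewrite -powRrM mulrNN divff ?gt_eqF// powRr1// ltW.
rewrite !(powRN _ a^-1) lef_pV2 ?posrE ?powR_gt0//.
by rewrite ge0_ler_powR ?nnegrE ?invr_ge0 ?powR_ge0// ltW.
Qed.

End weighted_powers.

(** * The one-sided inequality for F(x-) *)

Section cdf_left.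
Variables (R : realType) (mu : probability R R).
Local Notation F := (cdf_left mu).

Lemma cdf_leftE x : mu `]-oo, x[%classic = (F x)%:E.
Proof. by rewrite /cdf_left fineK// fin_num_measure. Qed.

Lemma cdf_left_ge0 x : 0 <= F x.
Proof. by rewrite -lee_fin -cdf_leftE. Qed.

Lemma cdf_left_nondecreasing x y : x <= y -> F x <= F y.
Proof.
move=> xy; rewrite -lee_fin -!cdf_leftE le_measure ?inE//.
by apply: subset_itvl; rewrite bnd_simp.
Qed.

Lemma measurable_cdf_left : measurable_fun setT F.
Proof.
by apply: nondecreasing_measurable => // x y; exact: cdf_left_nondecreasing.
Qed.

(* The null set is excluded because [0 `^ (- a) = 0] instead of [+oo]. *)
Lemma integral_cdf_left_powR_ge (a y : R) : 0 < a < 1 ->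
    mu.-negligible [set x | x <= y /\ F x = 0] ->
  ((F y `^ (1 - a) / (1 - a))%:E <=
   \int[mu]_x ((x <= y)%R%:R * F x `^ (- a))%:E)%E.
Proof.
move=> a01 null; have /andP[a0 a1] := a01.
have mw : measurable_fun setT (fun x : R => (x <= y)%R%:R : R).
  by apply: measurable_natr_bool; exact: measurable_fun_ler.
have mf : measurable_fun setT (fun x => F x `^ (- a)).
  exact: (measurableT_comp (measurable_powR (- a)) measurable_cdf_left).
have [Fy0|Fyn0] := eqVneq (F y) 0.
  rewrite Fy0 powR0 ?mul0r ?subr_eq0 ?gt_eqF//.
  by apply: integral_ge0 => x _; rewrite lee_fin mulr_ge0 ?powR_ge0.
have L0 : 0 < F y by rewrite lt_neqAle eq_sym Fyn0 cdf_left_ge0.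
rewrite layer_cake//; last by move=> x; exact: powR_ge0.
rewrite -integral_min_powR//.
apply: ge0_le_integral => //.
- by move=> s _; rewrite lee_fin le_min (ltW L0) powR_ge0.
- apply/measurable_EFinP; apply: measurable_funTS.
  by apply: measurable_minr => //; exact: measurable_powR.
- apply: measurable_funTS.
  exact: measurable_layers.
move=> s /=; rewrite in_itv/= andbT => s0.
set t := s `^ (- a^-1).
have t0 : 0 < t by exact: powR_gt0.
pose U := [set x | t <= F x].
have upU : upset U.
  by move=> x z /= tx /cdf_left_nondecreasing; exact: le_trans.
have mU : measurable U by exact: upset_measurable.
pose D := [set x | (x <= y) && (s < F x `^ (- a))].
have mD : measurable D.
  have := measurable_and
    (measurable_fun_ler (@measurable_id _ R setT) (measurable_cst y))
    (measurable_fun_ltr (measurable_cst s) mf).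
  by move=> /(_ measurableT [set true]); rewrite setTI; apply.
rewrite (_ : (\int[mu]_x _)%E = mu D); last first.
  rewrite -[RHS]mul1e -(integral_cst mu mD 1).
  rewrite (@integral_natr_bool _ _ _ mu (cst 1)
    (fun x => (x <= y) && (s < F x `^ (- a)))) //.
  by apply: eq_integral => x _; rewrite mul1r -natrM mulnb.
pose N := [set x | x <= y /\ F x = 0].
have mN : measurable N.
  rewrite (_ : N = `]-oo, y]%classic `&` F @^-1` [set 0]).
    apply: measurableI => //; rewrite -[X in measurable X]setTI.
    exact: measurable_cdf_left.
  by apply/seteqP; split => x /=; rewrite in_itv.
(* The points with [F x = 0] satisfy [F x < t] but lie outside [D], as the power is [0] there.
   Adding the null set [N] restores them. *)
have -> : mu D = (mu D + mu N)%E by rewrite (measure_negligible mN) ?adde0.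
apply: (le_trans _ (measureU2 _ _ _)) => //.
apply: (@le_trans _ _ (mu (`]-oo, y]%classic `\` U))); last first.
  apply: le_measure; rewrite ?inE//; [exact: measurableD|exact: measurableU|].
  move=> x [/=]; rewrite in_itv/= => xy /negP; rewrite -ltNge => Fxt.
  have [Fx0|Fx0] := eqVneq (F x) 0; [by right|left].
  have {}Fx0 : 0 < F x by rewrite lt_neqAle eq_sym Fx0 cdf_left_ge0.
  rewrite /D/= xy/=.
  have -> : s = t `^ (- a).
    by rewrite -powRrM mulrNN mulVf ?gt_eqF// powRr1// ltW.
  rewrite !powRN ltf_pV2 ?posrE ?powR_gt0//.
  by rewrite gt0_ltr_powR ?nnegrE// ltW.
(* If [F y < t], no point of []-oo, y]] lies in [U], and the mass is at least [F y]. Otherwise the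
   complement of [U] lies below [y], and its mass is at least [t]. *)
have [Uy|nUy] := pselect (U y); last first.
  rewrite (_ : _ `\` U = `]-oo, y]%classic); last first.
    apply/seteqP; split => [x []//|x /= xy]; split => // Ux.
    by apply: nUy; apply: upU Ux _; move: xy; rewrite in_itv.
  apply: (@le_trans _ _ (mu `]-oo, y[%classic)).
    by rewrite cdf_leftE lee_fin ge_min lexx.
  by apply: le_measure; rewrite ?inE//; apply: subset_itvl; rewrite bnd_simp.
rewrite (_ : _ `\` U = ~` U); last first.
  apply/seteqP; split => [x []//|x /= nUx]; split => //=; rewrite in_itv/=.
  by rewrite leNgt; apply/negP => /ltW yx; exact/nUx/(upU _ _ Uy yx).
rewrite probability_setC// EFin_min ge_min; apply/orP; right.
rewrite leeBrDr ?fin_num_measure//.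
have tF z : F z <= 1 by rewrite -lee_fin -cdf_leftE probability_le1.
suff : (mu U <= (1 - t)%:E)%E.
  move=> /(leeD2l t%:E); move/le_trans; apply.
  by rewrite -EFinD lee_fin addrCA subrr addr0.
(* A half-line that starts at a point [x] of [U] has mass [1 - F x <= 1 - t], and this bound passes
   to [U]. *)
have := @upset_integral_le R mu (cst 1%E) U (1 - t)%:E.
rewrite integral_cst// mul1e; apply => //.
  by rewrite lee_fin subr_ge0; exact: le_trans Uy (tF y).
move=> x /= Ux; rewrite integral_cst// mul1e.
apply: (@le_trans _ _ (1 - F x)%:E); last by rewrite lee_fin lerD2l lerN2.
by rewrite EFinB -cdf_leftE -probability_setC// setCitvl.
Qed.

End cdf_left.

(** * The reverse Hardy inequality for a probability measure on the line *)

Lemma weighted_amgm (R : realType) (p u v : R) :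
    0 < p < 1 -> 0 <= u -> 0 <= v ->
  u `^ p * v `^ (1 - p) <= p * u + (1 - p) * v.
Proof.
move=> /andP[p0 p1] u0 v0; have q0 : 0 < 1 - p by rewrite subr_gt0.
(* Young's inequality with the conjugate exponents [p^-1] and [(1 - p)^-1]. *)
have := @conjugate_powR _ (u `^ p) (v `^ (1 - p)) p^-1 (1 - p)^-1.
rewrite !invrK -!powRrM !divff ?gt_eqF// !powRr1// (mulrC p) (mulrC (1 - p)).
by apply; rewrite ?powR_ge0 ?invr_gt0// addrC subrK.
Qed.

(** The exponents of [r] add up to [(p - 1) * p + p * (1 - p) = 0]. With [r] the Hardy quotient,
    this is the equality that precedes AM-GM. *)
Lemma powR_interpolation (R : realType) (p b c r : R) :
  0 <= b -> 0 <= c -> 0 < r ->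
  (b * (c * r `^ (p - 1))) `^ p * (r `^ p) `^ (1 - p) = b `^ p * c `^ p.
Proof.
move=> b0 c0 r0; rewrite !powRM ?mulr_ge0 ?powR_ge0// -!mulrA.
rewrite -!powRrM -powRD; last by apply/implyP => _; rewrite gt_eqF.
by rewrite (_ : _ + _ = 0) ?powRr0 ?mulr1//; ring.
Qed.

Lemma measurable_inve_EFin d (T : measurableType d) (R : realType)
    (f : T -> R) :
    measurable_fun setT f -> (forall x, 0 <= f x) ->
  measurable_fun setT (fun x => (f x)%:E^-1)%E.
Proof.
move=> mf f0; rewrite (_ : (fun _ => _) =
    (fun x => if f x == 0 then +oo%E else (f x `^ (-1))%:E)); last first.
  by apply/funext => x; rewrite inver powR_inv1.
apply: measurable_fun_ifT => //; first exact: measurable_fun_eqr.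
exact/measurable_EFinP/(measurableT_comp (measurable_powR (-1))).
Qed.

(** The inverse is taken in the extended reals: where F(x-) vanishes the value is [+oo] if G(x) is
    positive and [0] if G(x) is zero. *)
Definition hardy_quotient (R : realType) (mu : probability R R) (psi : R -> R)
  (x : R) : \bar R := (tail_integral mu psi x * (cdf_left mu x)%:E^-1)%E.

Section reverse_hardy.
Variables (R : realType) (mu : probability R R) (psi : R -> R) (p : R).
Hypotheses (mpsi : measurable_fun setT psi) (psi0 : forall y, 0 <= psi y).
Hypotheses (p0 : 0 < p) (p1 : p < 1).

Local Notation F := (cdf_left mu).
Local Notation G := (tail_integral mu psi).
Local Notation H := (hardy_quotient mu psi).

Local Notation g := (fun x => fine (tail_integral mu psi x)).
Local Notation phi :=
  (fun y => psi y * fine (tail_integral mu psi y) `^ (p - 1)).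

Let mF : measurable_fun setT F := @measurable_cdf_left R mu.
Let mG : measurable_fun setT G := @measurable_tail_integral R mu psi mpsi psi0.

Lemma measurable_hardy_quotient_powR :
  measurable_fun setT (fun x => (H x) `^ p)%E.
Proof.
apply: (measurableT_comp (measurable_poweR p)).
apply: emeasurable_funM => //.
exact: measurable_inve_EFin mF (cdf_left_ge0 mu).
Qed.

Let H_ge0 x : (0 <= H x)%E.
Proof.
rewrite /hardy_quotient mule_ge0 ?inve_ge0 ?lee_fin ?cdf_left_ge0//.
exact: tail_integral_ge0.
Qed.

Let HE x : (G x < +oo)%E -> 0 < F x -> H x = (g x / F x)%:E.
Proof.
move=> Goo F0; rewrite /hardy_quotient inver gt_eqF//= EFinM fineK//.
by rewrite ge0_fin_numE// tail_integral_ge0.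
Qed.

(** This turns finiteness of H almost everywhere into the facts about F and G that make the
    conventions for powers at [0] and [+oo] harmless. *)
Let Hoo x : (0 < G x)%E -> (H x < +oo)%E -> (G x < +oo)%E /\ 0 < F x.
Proof.
rewrite /hardy_quotient => G0; have [F0|Fx0] := eqVneq (F x) 0.
  by rewrite /= F0 inver eqxx gt0_muley// ltxx.
have {}F0 : 0 < F x by rewrite lt_neqAle eq_sym Fx0 cdf_left_ge0.
rewrite /= inver gt_eqF// => Hoo; split => //; move: Hoo.
rewrite !ltey; apply: contra_neq => ->.
by rewrite gt0_mulye// lte_fin invr_gt0.
Qed.

Let mg (a : R) : measurable_fun setT (fun x => g x `^ a).
Proof.
apply: (measurableT_comp (measurable_powR a)).
exact: (measurableT_comp (fine_measurable measurableT) mG).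
Qed.

Let mFp (a : R) : measurable_fun setT (fun x => F x `^ a).
Proof. exact: (measurableT_comp (measurable_powR a)). Qed.

Let mphi : measurable_fun setT phi.
Proof. exact: measurable_funM. Qed.

Let phi0 y : 0 <= phi y.
Proof. by rewrite mulr_ge0 ?powR_ge0. Qed.

Let tail_phi_le x : (G x < +oo)%E ->
  (p%:E * \int[mu]_y (phi y * (x <= y)%R%:R)%:E <= (g x `^ p)%:E)%E.
Proof.
move=> Goo.
have /= := @integral_tail_powR_le R mu psi mpsi psi0 (1 - p) x _ Goo.
rewrite subr_gt0 p1 ltrBlDr ltrDl p0 => /(_ isT).
rewrite subKr opprB => h.
rewrite (_ : (\int[mu]_y _)%E = (\int[mu]_y
    (psi y * (x <= y)%R%:R * fine (G y) `^ (p - 1))%:E)%E).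
  by rewrite -lee_pdivlMl// -EFinM mulrC.
by apply: eq_integral => y _; rewrite /= mulrAC.
Qed.

Lemma integral_weight_le : {ae mu, forall x, (H x < +oo)%E} ->
  ((p / (1 - p))%:E * \int[mu]_y (phi y * F y `^ (1 - p))%:E <=
   \int[mu]_x (H x) `^ p)%E.
Proof.
move=> aeH; have mH := measurable_hardy_quotient_powR.
pose h x := (G x < +oo)%E%:R * F x `^ (- p).
have h0 x : 0 <= h x by rewrite mulr_ge0 ?powR_ge0.
have mh : measurable_fun setT h.
  apply: measurable_funM => //; apply: measurable_natr_bool.
  exact: measurable_fun_lte.
pose K x y := (h x * (phi y * (x <= y)%R%:R))%:E.
have K0 x y : (0 <= K x y)%E.
  by rewrite lee_fin mulr_ge0 ?h0 ?mulr_ge0 ?powR_ge0.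
have mK : measurable_fun setT (fun z : R * R => K z.1 z.2).
  apply/measurable_EFinP/measurable_funM.
    exact: (measurableT_comp mh measurable_fst).
  apply: measurable_funM; first exact: (measurableT_comp mphi measurable_snd).
  by apply: measurable_natr_bool; exact: measurable_fun_ler.
have q0 : 0 < 1 - p by rewrite subr_gt0.
apply: (@le_trans _ _ (p%:E * \int[mu]_x \int[mu]_y K x y))%E; last first.
  rewrite -ge0_integralZl//; last 3 first.
  - exact: (@measurable_fun_fubini_tonelli_F _ _ _ _ _ mu _ mK).
  - by move=> x _; exact: integral_ge0.
  - by rewrite lee_fin ltW.
  apply: ge0_le_integral => //.
  - by move=> x _; rewrite mule_ge0 ?lee_fin ?(ltW p0)//; exact: integral_ge0.
  - apply: measurable_funeM.
    exact: (@measurable_fun_fubini_tonelli_F _ _ _ _ _ mu _ mK).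
  move=> x _.
  have -> : (\int[mu]_y K x y =
      (h x)%:E * \int[mu]_y (phi y * (x <= y)%R%:R)%:E)%E.
    rewrite -ge0_integralZl//.
    - apply/measurable_EFinP/measurable_funM => //.
      by apply: measurable_natr_bool; exact: measurable_fun_ler.
    - by move=> y _; rewrite lee_fin mulr_ge0 ?phi0.
    - by rewrite lee_fin.
  rewrite muleCA /h; case: ltP => Goo; last by rewrite mul0r mul0e poweR_ge0.
  rewrite mul1r.
  have [F0|Fx0] := eqVneq (F x) 0.
    by rewrite F0 powR0 ?oppr_eq0 ?gt_eqF// mul0e poweR_ge0.
  have {}F0 : 0 < F x by rewrite lt_neqAle eq_sym Fx0 cdf_left_ge0.
  rewrite HE// poweR_EFin powRM ?invr_ge0 ?(ltW F0)//; last first.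
    exact/fine_ge0/tail_integral_ge0.
  rewrite -powR_inv1 ?(ltW F0)// -powRrM mulN1r mulrC EFinM.
  by apply: lee_wpmul2l; [rewrite lee_fin powR_ge0|exact: tail_phi_le].
rewrite EFinM -muleA; apply: lee_wpmul2l; first by rewrite lee_fin ltW.
rewrite (@fubini_tonelli _ _ _ _ _ mu mu _ mK)/=; last by move=> z; exact: K0.
rewrite -ge0_integralZl//; last 3 first.
- by apply/measurable_EFinP/measurable_funM.
- by move=> y _; rewrite lee_fin mulr_ge0 ?powR_ge0.
- by rewrite lee_fin invr_ge0 ltW.
apply: ge0_le_integral => //.
- by move=> y _; rewrite lee_fin !mulr_ge0 ?invr_ge0 ?powR_ge0// ltW.
- by apply/measurable_EFinP/measurable_funM => //; exact: measurable_funM.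
- exact: (@measurable_fun_fubini_tonelli_G _ _ _ _ _ mu _ mK).
move=> y _.
(* If [phi y] is nonzero then G is positive at [y], hence at every [x <= y]. Finiteness of H then
   makes F positive at almost all such [x], which is the null-set hypothesis of
   [integral_cdf_left_powR_ge]. *)
have [->|phiy0] := eqVneq (phi y) 0.
  by rewrite mul0r mule0 integral_ge0.
have Gy : (0 < G y)%E.
  rewrite lt_neqAle tail_integral_ge0// andbT; apply: contra_neq phiy0.
  by rewrite /= => <-/=; rewrite powR0 ?mulr0// subr_eq0 lt_eqF.
have Gx x : x <= y -> (0 < G x)%E.
  move=> xy; apply: lt_le_trans Gy _.
  exact: tail_integral_nonincreasing.
have null : mu.-negligible [set x | x <= y /\ F x = 0].
  apply: negligibleS aeH => x [xy Fx0] /= Hx.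
  by have [_] := Hoo (Gx _ xy) Hx; rewrite Fx0 ltxx.
have -> : (\int[mu]_x K x y =
    (phi y)%:E * \int[mu]_x ((x <= y)%R%:R * F x `^ (- p))%:E)%E.
  have mk : measurable_fun setT (fun x : R => (x <= y)%R%:R * F x `^ (- p)).
    apply: measurable_funM => //; apply: measurable_natr_bool.
    exact: measurable_fun_ler.
  rewrite -ge0_integralZl//; last 3 first.
  - exact/measurable_EFinP.
  - by move=> x _; rewrite lee_fin mulr_ge0 ?powR_ge0.
  - by rewrite lee_fin.
  apply: ge0_ae_eq_integral => //.
  - exact: (measurableT_comp mK (pair2_measurable y)).
  - by apply: measurable_funeM; exact/measurable_EFinP.
  - by move=> x _; rewrite mule_ge0 ?lee_fin ?mulr_ge0 ?powR_ge0.
  apply: filterS aeH => x Hx _; congr EFin; rewrite /K/h.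
  have [xy|] := leP x y; last by rewrite mulr0 mul0r !mulr0.
  by have [-> _] := Hoo (Gx _ xy) Hx; rewrite !mul1r mulr1 mulrC.
have := integral_cdf_left_powR_ge (a := p) _ null.
rewrite p0 p1 => /(_ isT) h1.
apply: le_trans (lee_wpmul2l _ h1); last by rewrite lee_fin.
by rewrite -!EFinM lee_fin /= mulrC !mulrA.
Qed.

Lemma reverse_hardy :
  (((p / (1 - p)) `^ p)%:E * \int[mu]_y (psi y `^ p)%:E <=
   \int[mu]_x (H x) `^ p)%E.
Proof.
have mH := measurable_hardy_quotient_powR.
have q0 : 0 < 1 - p by rewrite subr_gt0.
have [->|Aoo] := eqVneq (\int[mu]_x (H x) `^ p)%E +oo%E; first exact: leey.
have aeH : {ae mu, forall x, (H x < +oo)%E}.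
  have : mu.-integrable setT (fun x => (H x) `^ p)%E.
    apply/integrableP; split => //; rewrite ltey.
    by under eq_integral do rewrite gee0_abs ?poweR_ge0//.
  move/(integrable_ae measurableT); apply: filterS => x /(_ I).
  by rewrite ge0_fin_numE ?poweR_ge0//; apply: lty_poweRy; rewrite gt_eqF.
(* The level [t = 0] of [integral_tail_le]: [psi] has integral [0] over the set where G vanishes. *)
have aeG : {ae mu, forall y, (G y <= 0)%E -> psi y = 0}.
  pose Z := [set y | (G y <= 0)%E].
  have mZ : measurable Z.
    apply: upset_measurable => z y /= Gz zy; apply: le_trans Gz.
    exact: tail_integral_nonincreasing.
  have : (\int[mu]_(y in Z) `|(psi y)%:E| = 0)%E.
    apply/eqP; rewrite eq_le; apply/andP; split; last exact: integral_ge0.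
    under eq_integral do rewrite gee0_abs ?lee_fin//.
    exact: integral_tail_le.
  have mpsiZ := measurable_funTS (D := Z) ((measurable_EFinP _ _).2 mpsi).
  move/(ae_eq_integral_abs mu mZ mpsiZ).1.
  by apply: filterS => y + Gy => /(_ Gy) [].
set lam := p / (1 - p).
have lam0 : 0 < lam by rewrite divr_gt0.
pose W y := phi y * F y `^ (1 - p).
have W0 y : 0 <= W y by rewrite mulr_ge0 ?powR_ge0.
have pW0 y : (0 <= (p * lam * W y)%:E)%E.
  by rewrite lee_fin; apply: mulr_ge0 => //; rewrite mulr_ge0// ltW.
have qH0 y : (0 <= (1 - p)%:E * (H y) `^ p)%E.
  by rewrite mule_ge0 ?lee_fin ?(ltW q0) ?poweR_ge0.
have mW : measurable_fun setT W by exact: measurable_funM.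
have mpp : measurable_fun setT (fun y => psi y `^ p).
  exact: (measurableT_comp (measurable_powR p)).
rewrite -ge0_integralZl//; last 3 first.
- exact/measurable_EFinP.
- by move=> y _; rewrite lee_fin powR_ge0.
- by rewrite lee_fin powR_ge0.
apply: (@le_trans _ _
    (\int[mu]_y ((p * lam * W y)%:E + (1 - p)%:E * (H y) `^ p))%E).
  apply: ae_ge0_le_integral => //.
  - by move=> y _; rewrite lee_fin mulr_ge0 ?powR_ge0.
  - exact/measurable_EFinP/measurable_funM.
  - by move=> y _; exact: adde_ge0.
  - apply: emeasurable_funD; last exact: measurable_funeM.
    exact/measurable_EFinP/measurable_funM.
  apply: filterS2 aeH aeG => y Hy Gy _.
  have [psiy0|psiy0] := eqVneq (psi y) 0.
    by rewrite psiy0 powR0 ?gt_eqF// mule0; exact: adde_ge0.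
  have G0 : (0 < G y)%E.
    by rewrite ltNge; apply/negP => /Gy/eqP; apply/negP.
  have [Goo F0] := Hoo G0 Hy.
  have g0 : 0 < g y by rewrite fine_gt0// G0 Goo.
  rewrite HE// poweR_EFin -EFinM -EFinD lee_fin.
  have r0 : 0 < g y / F y by rewrite divr_gt0.
  have WE : W y = psi y * (g y / F y) `^ (p - 1).
    rewrite /W /= powRM ?invr_ge0 ?(ltW g0) ?(ltW F0)// -mulrA.
    congr (_ * (_ * _)).
    by rewrite -powR_inv1 ?(ltW F0)// -powRrM mulN1r opprB.
  have := @weighted_amgm R p (lam * W y) ((g y / F y) `^ p).
  rewrite p0 p1 mulr_ge0 ?(ltW lam0)// powR_ge0 => /(_ isT isT isT).
  rewrite -mulrA; apply: le_trans.
  by rewrite WE powR_interpolation// ltW.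
rewrite ge0_integralD//; last 2 first.
- exact/measurable_EFinP/measurable_funM.
- exact: measurable_funeM.
under eq_integral do rewrite -mulrA EFinM.
rewrite ge0_integralZl//; last 3 first.
- exact/measurable_EFinP/measurable_funM.
- by move=> y _; rewrite lee_fin mulr_ge0// ltW.
- by rewrite lee_fin ltW.
under eq_integral do rewrite EFinM.
rewrite ge0_integralZl//; last 3 first.
- exact/measurable_EFinP.
- by move=> y _; rewrite lee_fin.
- by rewrite lee_fin ltW.
rewrite ge0_integralZl//; last 2 first.
- by move=> y _; rewrite poweR_ge0.
- by rewrite lee_fin ltW.
apply: (@le_trans _ _ (p%:E * (\int[mu]_x (H x) `^ p) +
    (1 - p)%:E * (\int[mu]_x (H x) `^ p)))%E.
  apply: leeD2r; apply: lee_wpmul2l; first by rewrite lee_fin ltW.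
  exact: integral_weight_le.
rewrite -ge0_muleDl ?lee_fin ?(ltW p0) ?(ltW q0)//.
by rewrite -EFinD addrCA subrr addr0 mul1e.
Qed.

End reverse_hardy.

(** * From random variables to their common law *)

Section transfer.
Variables (d : measure_display) (T : measurableType d) (R : realType).
Variables (P : probability T R).

(** The half-lines []x, +oo[] are stable under intersection, generate the Borel sets and have mass
    one minus the distribution function. *)
Lemma distribution_eq_cdf (X Y : {RV P >-> R}) : cdf X = cdf Y ->
  forall A, measurable A -> distribution P X A = distribution P Y A.
Proof.
move=> XY A mA.
apply: (measure_unique (@RGenOInfty.G R)
  (fun n => `](- n%:R : R), +oo[%classic)) => //.
- exact: RGenOInfty.measurableE.
- move=> _ _ [x ->] [y ->]; exists (Num.max x y).
  by apply/seteqP; split => z /=; rewrite !in_itv/= !andbT gt_max => /andP.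
- by move=> n; exists (- n%:R).
- apply/seteqP; split => // x _; exists (Num.truncn (- x)).+1 => //=.
  by rewrite in_itv/= andbT ltrNl; exact: truncnS_gt.
- move=> _ [x ->].
  have XE (Z : {RV P >-> R}) :
      distribution P Z `]x, +oo[%classic = (1 - cdf Z x)%E.
    by rewrite -(setCitvl (BRight x)) probability_setC.
  by transitivity (1 - cdf X x)%E; [exact: XE|rewrite XY; exact/esym/XE].
- by move=> n; rewrite ltey_eq fin_num_measure.
Qed.

(** Continuity from below of the law gives the limit along [x - 1 / (n + 1)], and monotonicity of
    [F] extends it to the full left limit. *)
Lemma left_limit_cdf (X : {RV P >-> R}) (F : R -> R) (x : R) :
  is_distribution_function X F ->
  left_limit F x = cdf_left (distribution P X) x.
Proof.
move=> XF; set mu := distribution P X.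
have FE y : mu `]-oo, y]%classic = (F y)%:E by exact: XF.
have F_nd y z : y <= z -> F y <= F z.
  move=> yz; rewrite -lee_fin -!FE le_measure ?inE//.
  by apply: subset_itvl; rewrite bnd_simp.
have F_le y : y < x -> F y <= cdf_left mu x.
  move=> yx; rewrite -lee_fin -FE -cdf_leftE le_measure ?inE//.
  by apply: subset_itvl; rewrite bnd_simp.
pose u n := x - n.+1%:R^-1.
have ux n : u n < x by rewrite ltrBlDr ltrDl.
have cu : F (u n) @[n --> \oo] --> cdf_left mu x.
  have uE : `]-oo, x[%classic = \bigcup_n `]-oo, u n]%classic.
    apply/seteqP; split => [y|y [n _]]; rewrite /= !in_itv/=.
      move=> yx; have xy0 : 0 < x - y by rewrite subr_gt0.
      exists (Num.truncn (x - y)^-1) => //=; rewrite in_itv/= lerBrDr -lerBrDl.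
      by rewrite invf_ple ?posrE//; exact/ltW/truncnS_gt.
    by move=> /le_lt_trans; apply.
  have : (mu \o (fun n => `]-oo, u n]%classic)) n @[n --> \oo] -->
      (cdf_left mu x)%:E.
    rewrite -cdf_leftE uE; apply: nondecreasing_cvg_mu => //.
      exact: bigcup_measurable.
    move=> m n mn; apply/subsetPset; apply: subset_itvl; rewrite bnd_simp.
    by rewrite lerD2l lerN2 lef_pV2 ?posrE// ler_nat.
  move=> /fine_cvg; apply: cvg_trans; apply: near_eq_cvg.
  by apply: nearW => n /=; rewrite FE.
apply: cvg_lim => //; apply/cvgrPdist_lt => e e0.
move/cvgrPdist_lt : cu => /(_ e e0)[N _ /(_ N (leqnn N))/= uN].
near=> y.
have yx : y < x by near: y; exact: nbhs_left_lt.
have uy : u N < y by near: y; exact: nbhs_left_gt.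
move: uN; rewrite !ger0_norm ?subr_ge0 ?F_le//; apply: le_lt_trans.
by rewrite lerD2l lerN2 F_nd// ltW.
Unshelve. all: by end_near. Qed.

(** By independence the joint law agrees with the product measure on rectangles, hence
    everywhere. *)
Lemma ge0_integral_independent (X Y : {RV P >-> R}) (f : R * R -> \bar R) :
    independent_RVs X Y -> measurable_fun setT f -> (forall z, 0 <= f z)%E ->
  (\int[P]_w f (X w, Y w) =
   \int[distribution P X]_x \int[distribution P Y]_y f (x, y))%E.
Proof.
move=> XY mf f0.
have mXY : measurable_fun setT (fun w => (X w, Y w)).
  by apply/measurable_fun_pairP.
rewrite -(@fubini_tonelli1 _ _ _ _ _ (distribution P X) (distribution P Y))//.
transitivity (\int[pushforward P (fun w => (X w, Y w))]_z f z)%E.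
  by rewrite ge0_integral_pushforward.
apply: eq_measure_integral => A mA _; apply/esym.
exact: product_measure_unique.
Qed.

(** This is half of the almost sure uniqueness of conditional expectation; a lower bound on [C]
    suffices for the theorem. The set where [C < f (X w)] is covered by countably many events on
    which [C] is bounded and the gap is bounded below; equality of the integrals makes each of them
    null. *)
Lemma sub_cond_expectation_ae (X : {RV P >-> R}) (Z C : T -> \bar R)
    (f : R -> \bar R) : is_cond_expectation X Z C ->
    measurable_fun setT f -> (forall x, 0 <= f x)%E ->
    (forall B, measurable B ->
      \int[P]_(w in X @^-1` B) f (X w) = \int[P]_(w in X @^-1` B) Z w)%E ->
  {ae P, forall w, (f (X w) <= C w)%E}.
Proof.
move=> [C0 mC CZ] mf f0 fZ.
pose S := g_sigma_algebra_preimageType X.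
have mfX : measurable_fun setT ((f \o X) : S -> \bar R).
  apply: (measurableT_comp mf) => _ B mB.
  by exists B.
(* The integral of [C] is finite on [D k], hence it can be cancelled. *)
pose D k : set T :=
  [set w | (C w <= k%:R%:E)%E && (C w + k.+1%:R^-1%:E <= f (X w))%E].
have mDS k : g_sigma_algebra_preimage X (D k).
  have : measurable_fun setT (fun w : S =>
      (C w <= k%:R%:E)%E && (C w + k.+1%:R^-1%:E <= f (X w))%E).
    apply: measurable_and; first exact: measurable_fun_lee.
    by apply: measurable_fun_lee => //; exact: emeasurable_funD.
  by move=> /(_ measurableT [set true]); rewrite setTI; exact.
have DX k : exists2 B, measurable B & D k = X @^-1` B.
  by have [B mB <-] := mDS k; exists B => //; rewrite setTI.
have mD k : measurable (D k).
  have [B mB ->] := DX k; rewrite -[X in measurable X]setTI.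
  exact: measurable_funPT.
have mCT : measurable_fun setT C.
  move=> _ B mB; have [A mA <-] := mC measurableT B mB.
  rewrite setTI -[X in measurable X]setTI; exact: measurable_funPT.
have PD0 k : P (D k) = 0%E.
  have eqD : (\int[P]_(w in D k) f (X w) = \int[P]_(w in D k) C w)%E.
    by rewrite CZ//; have [B mB ->] := DX k; exact: fZ.
  have finD : (\int[P]_(w in D k) C w \is a fin_num)%E.
    rewrite ge0_fin_numE; last exact: integral_ge0.
    apply: (@le_lt_trans _ _ (\int[P]_(w in D k) (cst k%:R%:E) w)%E).
      apply: ge0_le_integral => //; first exact: measurable_funTS.
      by move=> w /andP[].
    by rewrite integral_cst// ltey_eq fin_numM// fin_num_measure.
  have : (\int[P]_(w in D k) (C w + (cst k.+1%:R^-1%:E) w) <=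
      \int[P]_(w in D k) f (X w))%E.
    apply: ge0_le_integral => //.
    - by move=> w _; rewrite adde_ge0//= lee_fin.
    - by apply: measurable_funTS; exact: emeasurable_funD.
    - by apply: measurable_funTS; exact: (measurableT_comp mf).
    - by move=> w /andP[].
  rewrite ge0_integralD//; last 2 first.
  - exact: measurable_funTS.
  - by move=> w _; rewrite lee_fin.
  rewrite eqD integral_cst// -[leRHS]adde0 leeD2lE// => PD.
  apply/eqP; rewrite eq_le measure_ge0 andbT.
  by move: PD; rewrite -[leRHS](mule0 k.+1%:R^-1%:E) lee_pmul2l//= lte_fin.
apply: (@negligibleS _ _ _ _ (\bigcup_k D k)); last first.
  apply: negligible_bigcup => k; exists (D k).
  by split; [exact: mD|exact: PD0|].
move=> w /= /negP; rewrite -ltNge => Cf.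
have Cfin : C w \is a fin_num by rewrite ge0_fin_numE// (lt_le_trans Cf) ?leey.
rewrite -(fineK Cfin) in Cf; set c := fine (C w) in Cf.
(* An index above [m] bounds both [C w] and the inverse of the gap. If [f (X w)] is [+oo] the second
   entry is meaningless, but the gap condition holds trivially. *)
set m := Num.max c (fine (f (X w)) - c)^-1.
have mk : m <= (Num.truncn m).+1%:R by exact/ltW/truncnS_gt.
exists (Num.truncn m).+1 => //; apply/andP; split.
  by rewrite -(fineK Cfin) lee_fin (le_trans _ mk)// le_max lexx.
move: mk; rewrite /m {m}; case: (f (X w)) Cf => [g|_ _|]; [|exact: leey|by []].
rewrite lte_fin -(fineK Cfin) -EFinD lee_fin => cg /= mk.
rewrite -lerBrDl invf_ple ?posrE ?subr_gt0//.
by rewrite (le_trans _ (le_trans mk _)) ?ler_nat// le_max lexx orbT.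
Qed.

End transfer.

(** Independence makes the right side a double integral against the common law, whose inner integral
    in [y] is the tail integral. So G(X) has the integrals that define E(psi(Y) 1[Y >= X] | X). *)
Lemma integral_preimage_tail (d : measure_display) (T : measurableType d)
    (R : realType) (P : probability T R) (X Y : {RV P >-> R})
    (psi : R -> R) (B : set R) :
    independent_RVs X Y ->
    (forall A, measurable A -> distribution P X A = distribution P Y A) ->
    measurable_fun setT psi -> (forall y, 0 <= psi y) -> measurable B ->
  (\int[P]_(w in X @^-1` B) tail_integral (distribution P X) psi (X w) =
   \int[P]_(w in X @^-1` B)
     (psi (Y w) * \1_[set w' | X w' <= Y w'] w)%:E)%E.
Proof.
move=> indep XY mpsi psi0 mB.
pose mu := distribution P X.
pose K (z : R * R) := (psi z.2 * (z.1 <= z.2)%R%:R * \1_B z.1)%:E.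
have mK : measurable_fun setT K.
  apply/measurable_EFinP; apply: measurable_funM.
    apply: measurable_funM; first exact: (measurableT_comp mpsi measurable_snd).
    by apply: measurable_natr_bool; exact: measurable_fun_ler.
  exact: (measurableT_comp (measurable_indic mB) measurable_fst).
have K0 z : (0 <= K z)%E by rewrite lee_fin !mulr_ge0.
transitivity (\int[P]_w K (X w, Y w))%E; last first.
  rewrite [RHS]integral_mkcond; apply: eq_integral => w _.
  rewrite patchE /K /= !indicE.
  rewrite (_ : (w \in X @^-1` B) = (X w \in B)); last first.
    by apply/idP/idP; rewrite !inE.
  rewrite (_ : (w \in [set w' | X w' <= Y w']) = (X w <= Y w)); last first.
    by apply/idP/idP; rewrite inE.
  by case: ifP; rewrite ?mulr1 ?mulr0.
rewrite ge0_integral_independent//.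
rewrite integral_mkcond.
transitivity (\int[mu]_x ((\1_B x)%:E * tail_integral mu psi x))%E.
  rewrite ge0_integral_distribution; last 2 first.
  - apply: emeasurable_funM; last exact: measurable_tail_integral.
    by apply/measurable_EFinP; exact: measurable_indic.
  - by move=> x; rewrite mule_ge0 ?lee_fin ?tail_integral_ge0.
  apply: eq_integral => w _; rewrite patchE /= indicE.
  rewrite (_ : (w \in X @^-1` B) = (X w \in B)); last first.
    by apply/idP/idP; rewrite !inE.
  by case: ifP; rewrite ?mul1e ?mul0e.
apply: eq_integral => x _.
rewrite tail_integralE -ge0_integralZl//; last 2 first.
- apply/measurable_EFinP/measurable_funM => //.
  by apply: measurable_natr_bool; exact: measurable_fun_ler.
- by move=> y _; rewrite lee_fin mulr_ge0.
rewrite (eq_measure_integral (distribution P Y)); last first.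
  by move=> A mA _; exact: XY.
by apply: eq_integral => y _; rewrite /K/= [RHS]EFinM muleC.
Qed.

(* The division on [\bar R] has [c / 0 = +oo] for [0 < c] and [0 / 0 = 0]. *)
Theorem theorem3p1 (d : measure_display) (T : measurableType d) (R : realType)
    (P : probability T R) (X Y : {RV P >-> R}) (F : R -> R)
    (hX : is_distribution_function X F) (hY : is_distribution_function Y F)
    (hXY : independent_RVs X Y)
    (psi : R -> R) (psi_meas : measurable_fun [set: R] psi)
    (psi_ge0 : forall y, 0 <= psi y)
    (C : T -> \bar R)
    (hC : is_cond_expectation X
      (fun w => (psi (Y w) * \1_[set w' | X w' <= Y w'] w)%:E) C)
    (p : R) (p_gt0 : 0 < p) (p_lt1 : p < 1) :
  ((\int[P]_w ((C w / (left_limit F (X w))%:E) `^ p)) `^ p^-1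
   >= (p / (1 - p))%:E * ('E_P[fun w => (psi (Y w) `^ p)%R]) `^ p^-1)%E.
Proof.
have XY : forall A, measurable A -> distribution P X A = distribution P Y A.
  by apply: distribution_eq_cdf; apply/funext => x; rewrite hX hY.
pose mu := distribution P X.
have mG := measurable_tail_integral mu psi_meas psi_ge0.
have mpp : measurable_fun setT (fun y => (psi y `^ p)%:E).
  exact/measurable_EFinP/(measurableT_comp (measurable_powR p)).
have EE : ('E_P[fun w => (psi (Y w) `^ p)%R] = \int[mu]_y (psi y `^ p)%:E)%E.
  rewrite (eq_measure_integral (distribution P Y)); last first.
    by move=> A mA _; exact: XY.
  rewrite ge0_integral_distribution//; last first.
    by move=> y; rewrite lee_fin powR_ge0.
  by rewrite unlock.
have GC : {ae P, forall w, (tail_integral mu psi (X w) <= C w)%E}.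
  apply: sub_cond_expectation_ae hC mG _ _ => [x|B mB].
    exact: tail_integral_ge0.
  exact: integral_preimage_tail.
have mF : measurable_fun setT (fun w => cdf_left mu (X w)).
  exact: (measurableT_comp (@measurable_cdf_left R mu)).
have mC : measurable_fun setT C.
  case: hC => _ mC _ _ B mB; have [A mA <-] := mC measurableT B mB.
  rewrite setTI -[X in measurable X]setTI; exact: measurable_funPT.
have C0 w : (0 <= C w)%E by case: hC.
have mI : measurable_fun setT (fun w => (cdf_left mu (X w))%:E^-1)%E.
  by apply: measurable_inve_EFin => // w; exact: cdf_left_ge0.
have main : (\int[mu]_x (hardy_quotient mu psi x) `^ p <=
    \int[P]_w (C w / (left_limit F (X w))%:E) `^ p)%E.
  have I0 w : (0 <= (cdf_left mu (X w))%:E^-1)%E.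
    by rewrite inve_ge0 lee_fin cdf_left_ge0.
  under [leRHS]eq_integral do rewrite (left_limit_cdf _ hX).
  rewrite ge0_integral_distribution; last 2 first.
  - exact: measurable_hardy_quotient_powR.
  - by move=> x; exact: poweR_ge0.
  apply: ae_ge0_le_integral => //.
  - by move=> w _; exact: poweR_ge0.
  - apply: (measurableT_comp (measurable_poweR p)).
    apply: emeasurable_funM => //; exact: (measurableT_comp mG).
  - by move=> w _; exact: poweR_ge0.
  - apply: (measurableT_comp (measurable_poweR p)).
    exact: emeasurable_funM.
  apply: filterS GC => w GCw _.
  apply: gt0_ler_poweR; rewrite ?in_itv/= ?leey ?andbT ?(ltW p_gt0)//.
  - by rewrite mule_ge0 ?tail_integral_ge0.
  - by rewrite mule_ge0.
  by apply: lee_wpmul2r.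
have pinv : (0 <= p^-1)%R by rewrite invr_ge0 ltW.
have lam0 : (0 <= p / (1 - p))%R by rewrite divr_ge0 ?subr_ge0 ?ltW.
rewrite EE.
(* The constant is moved under the root, so that monotonicity of the power [p^-1] leaves exactly
   [reverse_hardy] followed by [main]. *)
have -> : ((p / (1 - p))%:E = ((p / (1 - p)) `^ p)%:E `^ p^-1)%E.
  by rewrite poweR_EFin -powRrM divff ?gt_eqF// powRr1.
have E0 : (0 <= \int[mu]_y (psi y `^ p)%:E)%E.
  by apply: integral_ge0 => y _; rewrite lee_fin powR_ge0.
rewrite -poweRM ?lee_fin ?powR_ge0//.
apply: gt0_ler_poweR; rewrite ?in_itv/= ?leey ?andbT//.
- by rewrite mule_ge0 ?lee_fin ?powR_ge0.
- by apply: integral_ge0 => w _; exact: poweR_ge0.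
apply: le_trans main; exact: reverse_hardy.
Qed.
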